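(* Let $g\ge 3$ be an odd integer. If $G$ is a simple graph on $n$ vertices with girth at least $g-1$, then $P^*_{DP}(G,m) - P(G,m) = O(m^{n-g+1})$ as $m\to\infty$.
   Context: $P(G,m)$ is the number of proper colorings of $G$ with colors from $[m]=\{1,\dots,m\}$ (chromatic polynomial). A cover of a simple graph $G$ is a pair (list assignment, graph) $\mathcal{H}=(L,H)$ where $L$ assigns to each vertex $x$ a finite set $L(x)$, the sets $L(x)$ pairwise disjoint, $H$ is a simple graph on $\bigcup_x L(x)$ in which each $L(x)$ induces a clique, the edges of $H$ between $L(u)$ and $L(v)$ form a matching, and there are no such edges if $uv\notin E(G)$. It is a full $m$-fold cover if each $|L(x)|=m$ and for every edge $uv$ of $G$ the edges between $L(u)$ and $L(v)$ form a perfect matching. An $\mathcal{H}$-coloring is an independent set of $H$ of size $|V(G)|$; $P_{DP}(G,\mathcal{H})$ is their number. The dual DP color function $P^*_{DP}(G,m)$ is the maximum of $P_{DP}(G,\mathcal{H})$ over all full $m$-fold covers $\mathcal{H}$ of $G$. An acyclic graph has infinite girth. *)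

(* Defs.v *)
From mathcomp Require Import all_boot all_order all_algebra.
From mathcomp Require Import all_classical all_reals all_analysis.

Set Implicit Arguments.
Unset Strict Implicit.
Unset Printing Implicit Defensive.

Import Order.TTheory GRing.Theory Num.Theory.
Import numFieldNormedType.Exports.

Local Open Scope classical_set_scope.

Record sgraph (V : finType) := SGraph {
  edge :> rel V;
  edge_sym : symmetric edge;
  edge_irrefl : irreflexive edge }.

Definition proper_coloring (V : finType) (G : sgraph V) (m : nat)
    (f : {ffun V -> 'I_m}) : bool :=
  [forall u, forall v, G u v ==> (f u != f v)].

Definition chromatic_poly (V : finType) (G : sgraph V) (m : nat) : nat :=
  #|[set f : {ffun V -> 'I_m} | proper_coloring G f]%SET|.

Definition is_cycle (V : finType) (G : sgraph V) (c : seq V) : Prop :=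
  (3 <= size c)%N /\ ucycle G c.

(* The infimum of the empty set is +oo, so acyclic graphs have infinite
   girth. *)
Definition girth (R : realType) (V : finType) (G : sgraph V) : \bar R :=
  ereal_inf [set (size c)%:R%:E | c in is_cycle G].

(* The edges of H between A and B form a matching: two of them that share an
   endpoint coincide. Only used for disjoint A and B. *)
Definition matching_between (W : finType) (H : sgraph W) (A B : {set W}) :
    Prop :=
  forall a a' b b', a \in A -> a' \in A -> b \in B -> b' \in B ->
    H a b -> H a' b' -> a = a' \/ b = b' -> a = a' /\ b = b'.

Definition perfect_matching_between (W : finType) (H : sgraph W)
    (A B : {set W}) : Prop :=
  [/\ matching_between H A B,
      forall a, a \in A -> exists2 b, b \in B & H a b
    & forall b, b \in B -> exists2 a, a \in A & H a b].

Record cover (V : finType) (G : sgraph V) := Cover {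
  cvertex : finType;
  clist : V -> {set cvertex};
  cgraph : sgraph cvertex;
  clist_disjoint : forall u v, u != v -> clist u :&: clist v = finset.set0;
  clist_cover : forall a, exists u, a \in clist u;
  clist_clique : forall u a b,
    a \in clist u -> b \in clist u -> a != b -> cgraph a b;
  clist_matching : forall u v, u != v ->
    matching_between cgraph (clist u) (clist v);
  clist_nonadjacent : forall u v a b, u != v -> ~~ G u v ->
    a \in clist u -> b \in clist v -> ~~ cgraph a b }.

Definition full_cover (V : finType) (G : sgraph V) (m : nat) (C : cover G) :
    Prop :=
  (forall u, #|clist C u| = m) /\
  (forall u v, G u v ->
    perfect_matching_between (cgraph C) (clist C u) (clist C v)).

Definition independent (W : finType) (H : sgraph W) (S : {set W}) : bool :=
  [forall a in S, forall b in S, ~~ H a b].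

Definition PDP (V : finType) (G : sgraph V) (C : cover G) : nat :=
  #|[set S : {set cvertex C} |
      independent (cgraph C) S && (#|S| == #|V|)]%SET|.

Definition PDP_values (V : finType) (G : sgraph V) (m : nat) : set nat :=
  [set k | exists2 C : cover G, full_cover m C & PDP C = k].

(* The greatest element of PDP_values G m; it exists by dual_PDPP below, so
   the default value 0 is never used. *)
Definition dual_PDP (V : finType) (G : sgraph V) (m : nat) : nat :=
  xget 0%N (PDP_values G m `&` ubound (PDP_values G m)).

Section DualIsMaximum.
Variables (V : finType) (G : sgraph V) (m : nat).

Let W : finType := (V * 'I_m)%type.
Let E : rel W := fun a b =>
  ((a.1 == b.1) && (a.2 != b.2)) || (G a.1 b.1 && (a.2 == b.2)).

Let E_sym : symmetric E.
Proof. by move=> a b; rewrite /E edge_sym (eq_sym a.1) (eq_sym a.2). Qed.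

Let E_irrefl : irreflexive E.
Proof. by move=> a; rewrite /E !eqxx edge_irrefl. Qed.

Let H : sgraph W := SGraph E_sym E_irrefl.
Let L (u : V) : {set W} := [set a : W | a.1 == u]%SET.

Let inL u a : (a \in L u) = (a.1 == u). Proof. by rewrite inE. Qed.

Let L_disjoint u v : u != v -> L u :&: L v = finset.set0.
Proof.
move=> uv; apply/setP => a; rewrite !inE; apply/negbTE/negP.
by case/andP=> /eqP -> /eqP e; rewrite e eqxx in uv.
Qed.

Let L_cover a : exists u, a \in L u.
Proof. by exists a.1; rewrite inL. Qed.

Let L_clique u a b : a \in L u -> b \in L u -> a != b -> H a b.
Proof.
case: a b => [x i] [y j]; rewrite !inL /= /E /= => /eqP -> /eqP ->.
by rewrite eqxx /= xpair_eqE eqxx /= => ->.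
Qed.

Let L_matching u v : u != v -> matching_between H (L u) (L v).
Proof.
move=> /negbTE uv [x i] [x' i'] [y j] [y' j']; rewrite !inL /= /E /=.
move=> /eqP -> /eqP -> /eqP -> /eqP ->; rewrite uv /=.
by move=> /andP[_ /eqP ->] /andP[_ /eqP ->] [] [->].
Qed.

Let L_nonadjacent u v a b : u != v -> ~~ G u v ->
  a \in L u -> b \in L v -> ~~ H a b.
Proof.
move=> /negbTE uv /negbTE nG; rewrite !inL /= /E => /eqP -> /eqP ->.
by rewrite uv nG.
Qed.

Let canonical_cover : cover G :=
  Cover L_disjoint L_cover L_clique L_matching L_nonadjacent.

Let full_canonical_cover : full_cover m canonical_cover.
Proof.
split=> [u|u v Guv] /=.
  have -> : L u = [set (u, i) | i in 'I_m]%SET.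
    apply/setP=> -[x i]; rewrite inL /=.
    apply/eqP/imsetP => [->|[j _ [-> _]]//]; by exists i.
  by rewrite card_imset ?card_ord // => i j [].
split=> [|[x i]|[x i]]; rewrite ?inL /=.
- apply: L_matching; apply: contraTneq Guv => ->; by rewrite edge_irrefl.
- by move=> /eqP ->; exists (v, i); rewrite ?inL //= /E /= Guv eqxx orbT.
- by move=> /eqP ->; exists (u, i); rewrite ?inL //= /E /= Guv eqxx orbT.
Qed.

Lemma PDP_full_le (C : cover G) :
  full_cover m C -> (PDP C <= 2 ^ (#|V| * m))%N.
Proof.
case=> Lm _; have cW : (#|cvertex C| <= #|V| * m)%N.
  have -> : #|cvertex C| = #|\bigcup_u clist C u|%SET.
    rewrite -cardsT; congr #|pred_of_set _|; apply/setP=> a.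
    rewrite finset.in_setT.
    by apply/esym/bigcupP; have [u au] := clist_cover a; exists u.
  rewrite -sum_nat_const.
  apply: (big_ind2 (fun (A : {set cvertex C}) k => #|A| <= k)%N) => //.
  - by rewrite cards0.
  - move=> A x B y Ax By.
    by apply: leq_trans (leq_add Ax By); rewrite leq_card_setU.
  - by move=> u _; rewrite Lm.
apply: leq_trans (max_card _) _.
rewrite -cardsT -powersetT card_powerset cardsT.
by rewrite leq_exp2l.
Qed.

Lemma dual_PDPP : (PDP_values G m `&` ubound (PDP_values G m)) (dual_PDP G m).
Proof.
apply: xgetPex.
have exP : exists k, `[< PDP_values G m k >].
  by exists (PDP canonical_cover); apply/asboolP; exists canonical_cover.
have bP k : `[< PDP_values G m k >] -> (k <= 2 ^ (#|V| * m))%N.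
  by move/asboolP => [C /PDP_full_le + <-].
case: (ex_maxnP exP bP) => k /asboolP Pk kmax.
by exists k; split=> // j Pj; rewrite leEnat; apply: kmax; apply/asboolP.
Qed.

End DualIsMaximum.

(* Main.v *)
Require Import Defs.
From mathcomp Require Import all_boot all_order all_algebra perm.
From mathcomp Require Import all_classical all_reals all_analysis.
From mathcomp Require Import zify.

(** Identify every list of a full [m]-fold cover with ['I_m] and apply
    inclusion-exclusion over the edge sets [A] of [G]: the number of colorings
    is the sum of [(-1)^|A| N(A)], where [N(A)] counts the transversals that
    violate all edges of [A]. The chromatic polynomial arises in the same way
    from the cover with identity matchings, where [N(A) = m^k(A)] with [k(A)]
    the number of components of [(V, A)]; in general [N(A) <= m^k(A)]. If [A]
    is acyclic, relabelling the lists makes all matchings on [A] trivial and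
    the two terms agree. If [A] contains a cycle, that cycle has length at
    least [g - 1]; then either [k(A) <= n - g + 1], or [A] is exactly a cycle
    of length [g - 1], because a chord would give a shorter cycle. In the
    latter case [|A|] is even, so the term of the cover is at most that of the
    chromatic polynomial. *)

Set Implicit Arguments.
Unset Strict Implicit.
Unset Printing Implicit Defensive.

Import Order.TTheory GRing.Theory Num.Theory.

(** Expand the product of [F i + 1], where [F] is -1 on [B] and 0 elsewhere: any element of [B]
    makes a factor vanish, and subsets not inside [B] contribute 0. *)
Lemma sum_sign_subset (I : finType) (B : {set I}) :
  (\sum_(A : {set I} | A \subset B) (-1) ^+ #|A| =
   (B == finset.set0)%:R :> int)%R.
Proof.
pose F i : int := (if i \in B then -1 else 0)%R.
have -> : ((B == finset.set0)%:R = \prod_i (F i + 1) :> int)%R.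
  case: (set_0Vmem B) => [B0|[x xB]].
    by rewrite {1}B0 eqxx big1 // => i _; rewrite /F B0 finset.in_set0 add0r.
  rewrite (bigD1 x) //= /F xB addNr mul0r.
  by case: eqP xB => // ->; rewrite finset.in_set0.
rewrite bigA_distr [RHS](bigID (fun A : {set I} => A \subset B)) /=.
rewrite [X in (_ + X)%R]big1 ?addr0; last first.
  move=> A /subsetPn [x xA xB].
  by rewrite (bigD1 x) //= xA /F (negbTE xB) mul0r.
apply: eq_bigr => A /fintype.subsetP AB.
rewrite -big_mkcond (eq_bigr (fun=> -1)%R) ?prodr_const //.
by move=> i /AB iB; rewrite /F iB.
Qed.

(** * Cycles and components of edge sets *)

Section EdgeSets.
Variables (V : finType) (G : sgraph V).
Implicit Types (A : {set V * V}) (c : seq V).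

(* Every edge occurs once, oriented along the enumeration of the vertices. *)
Definition arcs : {set V * V} :=
  [set e | G e.1 e.2 & enum_rank e.1 < enum_rank e.2]%SET.

Definition arc_rel A : rel V := fun u v => ((u, v) \in A) || ((v, u) \in A).

Lemma arc_rel_sym A : symmetric (arc_rel A).
Proof. by move=> u v; rewrite /arc_rel orbC. Qed.

Lemma arc_rel_connect_sym A : connect_sym (arc_rel A).
Proof. by apply: sym_connect_sym; apply: arc_rel_sym. Qed.

Lemma arc_relS A A' : A \subset A' -> subrel (arc_rel A) (arc_rel A').
Proof.
move=> /fintype.subsetP AA' u v /orP[/AA' | /AA'] e; rewrite /arc_rel e //.
by rewrite orbT.
Qed.

Lemma arc_rel_arcs u v : G u v = arc_rel arcs u v.
Proof.
rewrite /arc_rel !inE /= (edge_sym G v u) -andb_orr; case Guv: (G u v) => //=.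
rewrite -neq_ltn; apply/esym; apply: contraFneq (edge_irrefl G u) => /val_inj.
by move=> /enum_rank_inj {2}->.
Qed.

Lemma arc_rel_edge A u v : A \subset arcs -> arc_rel A u v -> G u v.
Proof. by move=> AE /(arc_relS AE); rewrite arc_rel_arcs. Qed.

Lemma arcs_asym u v : (u, v) \in arcs -> (v, u) \notin arcs.
Proof.
by rewrite !inE /= => /andP[_ uv]; rewrite negb_and -leqNgt (ltnW uv) orbT.
Qed.

(** A simple path from [u] to [v] that avoids the arc [(u, v)] is closed by that arc. *)
Lemma cycle_of_connected_arc A u v :
  A \subset arcs -> (u, v) \in A -> connect (arc_rel (A :\ (u, v))) u v ->
  exists c, 2 < size c /\ ucycle (arc_rel A) c.
Proof.
move=> AE uvA /connectP [p0 /shortenP [p pp up _]] vl.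
have uvE : (u, v) \in arcs by apply: (fintype.subsetP AE).
have vuA : (v, u) \notin A.
  by apply: contra (arcs_asym uvE) => /(fintype.subsetP AE).
exists (u :: p); split; last first.
  rewrite /ucycle /ucycleb up andbT /= rcons_path -vl; apply/andP; split.
    apply: sub_path pp; apply: arc_relS; exact: subsetDl.
  by rewrite /arc_rel uvA orbT.
(* A path without steps would make [(u, v)] a loop; a single step would need the reversed arc, which
   the orientation excludes. *)
case: p pp vl {up} => [_ /= vu|w [|w' p]] //=.
  by move: vuA; rewrite -vu in uvA *; rewrite uvA.
move=> /andP [uw _] vw; move: uw.
by rewrite -vw /arc_rel !inE eqxx (negbTE vuA) andbF.
Qed.

Section CycleArcs.
Variables (A : {set V * V}) (c : seq V).
Hypothesis (AE : A \subset arcs) (Uc : uniq c) (c3 : 2 < size c).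
Hypothesis (Cc : cycle (arc_rel A) c).

Let next_next x : x \in c -> next c (next c x) != x.
Proof.
move=> xc; have [i p cp] := rot_to xc.
have Ur : uniq (x :: p) by rewrite -cp rot_uniq.
rewrite -!(next_rot i Uc) cp.
have: 2 < size (x :: p) by rewrite -cp size_rot.
case: p Ur {cp} => [|y [|z p]] //= /and3P [+ _ _] _ .
rewrite !eqxx !inE !negb_or => /and3P [xy xz _].
have /negbTE yx : y != x by rewrite eq_sym.
by rewrite yx; case: p  => [|w p] /=; rewrite ?eqxx eq_sym.
Qed.

(** Sending each vertex of [c] to the arc that joins it to its successor, in whichever orientation
    lies in [A], is a bijection onto [A]. *)
Lemma card_cycle_arcs :
  (forall u v, arc_rel A u v -> u \in c /\ (v = next c u \/ u = next c v)) ->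
  #|A| = size c.
Proof.
move=> Ac.
pose F x := if (x, next c x) \in A then (x, next c x) else (next c x, x).
have FA x : x \in c -> F x \in A.
  by move=> /(next_cycle Cc); rewrite /F /arc_rel; case: ifP.
have -> : A = [set F x | x in c]%SET.
  apply/setP => -[u v]; apply/idP/imsetP => [uvA|[x /FA ? ->] //].
  have [|uc uv] := Ac u v; first by rewrite /arc_rel uvA.
  have vc : v \in c by have [] := Ac v u; first by rewrite /arc_rel uvA orbT.
  have vuA : (v, u) \notin A.
    apply: contra (arcs_asym (fintype.subsetP AE _ uvA)).
    exact: (fintype.subsetP AE).
  by case: uv => e; [exists u|exists v] => //; rewrite /F -e ?uvA ?(negbTE vuA).
rewrite card_in_imset; first exact/card_uniqP.
move=> x y xc yc; rewrite /F.
(* If the images agree with opposite orientations, [x] and [y] are each other's successors. *)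
have := next_next xc; case: ifP; case: ifP => _ _ + [] //.
- by move=> + xy e; rewrite e -xy eqxx.
- by move=> + e xy; rewrite e -xy eqxx.
Qed.

Lemma cycle_connect x y : x \in c -> y \in c -> connect (arc_rel A) x y.
Proof.
move=> xc; have [i p cp] := rot_to xc.
rewrite -(mem_rot i) cp; have: cycle (arc_rel A) (rot i c) by rewrite rot_cycle.
rewrite cp /= rcons_path => /andP [pp _].
exact: path_connect pp y.
Qed.

(** The chord closes the stretch of [c] from [u] to [v]. This stretch has an interior vertex because
    [v] does not follow [u], and misses a vertex of [c] because [u] does not follow [v]. *)
Lemma chord_short_cycle u v :
  u \in c -> v \in c -> arc_rel A u v -> v <> next c u -> u <> next c v ->
  exists c', is_cycle G c' /\ size c' < size c.
Proof.
move=> uc vc Auv; have [i p cp] := rot_to uc.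
have Ur : uniq (u :: p) by rewrite -cp rot_uniq.
have: cycle (arc_rel A) (rot i c) by rewrite rot_cycle.
rewrite -!(next_rot i Uc) -(size_rot i c) cp.
have uv : u != v.
  by apply: contraTneq (arc_rel_edge AE Auv) => ->; rewrite edge_irrefl.
have vp : v \in p.
  by move: vc; rewrite -(mem_rot i) cp inE eq_sym (negbTE uv).
case/splitPr: vp Ur {cp} => p1 p2 Ur Cp vu uu; exists (u :: rcons p1 v); split; last first.
  rewrite /= size_rcons size_cat /=; case: p2 uu Ur {Cp vu} => [|w p2] uu Ur.
    have /negbTE vp1 : v \notin p1.
      by move: Ur; rewrite cats1 /= rcons_uniq => /and3P [].
    (* With [v] last on the cycle, its index runs past the tail, so [next_nth] returns the default
       value, the head [u]. *)
    case: uu; rewrite next_nth inE mem_cat mem_head !orbT /= (negbTE uv).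
    by rewrite index_cat vp1 /= eqxx addn0 nth_default // size_cat addn1.
  by rewrite !addnS !ltnS leq_addr.
split.
  case: p1 vu {uu Cp Ur} => [|w p1] /=; first by rewrite !eqxx.
  by rewrite size_rcons.
apply/andP; split; last first.
  by move: Ur; rewrite -cat_rcons -cat_cons cat_uniq => /and3P [].
apply: (@sub_cycle _ (arc_rel A)) => [y z|]; first exact: arc_rel_edge.
move: Cp; rewrite /= -cat_rcons rcons_cat cat_path => /andP [Cp _].
by rewrite rcons_path Cp last_rcons arc_rel_sym.
Qed.

End CycleArcs.

(** A set [T] that meets every component of [(V, A)] stands in for the number of components. One
    vertex of [c] together with all vertices off [c] is small enough unless [c] has length
    [g - 1]. *)
Lemma cyclic_arcs_cases A c g :
  A \subset arcs -> 2 < size c -> ucycle (arc_rel A) c ->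
  odd g -> (forall c', is_cycle G c' -> g <= (size c').+1) ->
  ~~ odd #|A| \/
  exists2 T : {set V}, #|T| + g <= #|V|.+1 &
    forall v, exists2 t, t \in T & connect (arc_rel A) t v.
Proof.
move=> AE c3 /andP [Cc Uc] og girth_g.
have gc : g <= (size c).+1.
  apply: girth_g; split=> //; apply/andP; split=> //.
  by apply: sub_cycle Cc => u v; apply: arc_rel_edge.
have [x xc] : exists x, x \in c.
  by case: (c) c3 => // x p _; exists x; rewrite mem_head.
pose D := [set y in c]%SET.
have cD : #|D| = size c by rewrite cardsE; apply/card_uniqP.
have cDC : #|~: D|%SET + size c = #|V| by rewrite addnC -cD cardsC.
case: (leqP g (size c)) => [gl|lg].
  right; exists (x |: ~: D)%SET.
    by rewrite cardsU1 !inE xc /= -cDC add1n addSn ltnS leq_add2l.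
  move=> v; case: (boolP (v \in c)) => vc; last first.
    by exists v; rewrite ?inE ?vc ?orbT.
  by exists x; [rewrite !inE eqxx|apply: (cycle_connect Cc)].
have {gc lg} gc : g = (size c).+1 by apply/eqP; rewrite eqn_leq gc lg.
(* Now [c] has length [g - 1]. If all arcs stay on its vertices, a chord would contradict the girth
   bound, so [A] is the cycle itself and has even size. *)
case: (boolP [forall u, forall v, arc_rel A u v ==> (u \in c)]) => [Ac|].
  left; suff -> : #|A| = size c by move: og; rewrite gc /=.
  apply: card_cycle_arcs => // u v Auv.
  have inc y z : arc_rel A y z -> y \in c.
    by move/forallP: Ac => /(_ y) /forallP /(_ z) /implyP.
  have uc := inc _ _ Auv; split=> //.
  have vc : v \in c by apply: (inc v u); rewrite arc_rel_sym.
  case: (eqVneq v (next c u)) => [->|/eqP vu]; first by left.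
  case: (eqVneq u (next c v)) => [->|/eqP uv]; first by right.
  have [c' [/girth_g]] := chord_short_cycle AE Uc Cc uc vc Auv vu uv.
  by rewrite gc ltnS leqNgt => /negbTE ->.
rewrite negb_forall => /existsP [u]; rewrite negb_forall => /existsP [v].
rewrite negb_imply => /andP [Auv uc]; right.
exists (x |: (~: D :\ u))%SET.
  have uD : u \in (~: D)%SET by rewrite !inE.
  by rewrite cardsU1 !inE xc /= andbF /= gc -cDC (cardsD1 u (~: D)) uD addnS.
have dom v' : v' != u ->
    exists2 t, t \in (x |: (~: D :\ u))%SET & connect (arc_rel A) t v'.
  move=> v'u; case: (boolP (v' \in c)) => vc.
    by exists x; [rewrite !inE eqxx|apply: (cycle_connect Cc)].
  by exists v'; rewrite ?connect0 // !inE v'u vc orbT.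
move=> v'; case: (eqVneq v' u) => [->|]; last exact: dom.
have [|t tT tv] := dom v.
  by apply: contraTneq (arc_rel_edge AE Auv) => ->; rewrite edge_irrefl.
exists t => //; apply: (connect_trans tv); apply: connect1.
by rewrite arc_rel_sym.
Qed.


End EdgeSets.

(** * Inclusion-exclusion for twisted colorings *)

Section TwistedColorings.
Variables (V : finType) (G : sgraph V) (m : nat).
Implicit Types (A : {set V * V}) (s : V -> V -> 'I_m -> 'I_m).
Implicit Types (f : {ffun V -> 'I_m}).

(* A full m-fold cover with all lists identified with 'I_m: the edge uv of G
   carries the perfect matching that joins i in L(u) to s u v i in L(v). *)
Definition matching_system s : Prop :=
  forall u v, G u v -> cancel (s u v) (s v u).

Definition twisted_colorings s : {set {ffun V -> 'I_m}} :=
  [set f : {ffun V -> 'I_m} |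
    [forall u, forall v, G u v ==> (s u v (f u) != f v)]]%SET.

Definition violating s A : {set {ffun V -> 'I_m}} :=
  [set f : {ffun V -> 'I_m} | [forall e in A, s e.1 e.2 (f e.1) == f e.2]]%SET.

Definition untwisted : V -> V -> 'I_m -> 'I_m := fun _ _ => id.

Lemma matching_system_untwisted : matching_system untwisted.
Proof. by []. Qed.

Lemma twisted_colorings_untwisted :
  #|twisted_colorings untwisted| = chromatic_poly G m.
Proof. by []. Qed.

Lemma violatingP s A f :
  reflect (forall u v, (u, v) \in A -> s u v (f u) = f v) (f \in violating s A).
Proof.
rewrite inE; apply: (iffP forall_inP) => fA => [u v uvA|[u v] uvA].
  by have /eqP := fA _ uvA.
by apply/eqP/fA.
Qed.

(** Here [B f] is the set of arcs violated by [f]. The indicator that it is empty becomes an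
    alternating sum by [sum_sign_subset], and the two sums are exchanged. *)
Lemma twisted_colorings_inclusion_exclusion s : matching_system s ->
  (#|twisted_colorings s|%:Z =
   \sum_(A : {set V * V} | A \subset arcs G)
     (-1) ^+ #|A| * #|violating s A|%:Z)%R.
Proof.
move=> sK; pose B f := [set e in arcs G | s e.1 e.2 (f e.1) == f e.2]%SET.
have tB f : (f \in twisted_colorings s) = (B f == finset.set0).
  rewrite inE; apply/forallP/eqP => [fP|B0 u].
    apply/setP => -[u v]; rewrite finset.in_set0 !inE /=; apply/negP.
    move=> /andP [/andP [Guv _] /eqP e].
    by have /forallP/(_ v) := fP u; rewrite Guv e eqxx.
  apply/forallP => v; apply/implyP => Guv; apply/eqP => e.
  have: arc_rel (arcs G) u v by rewrite -arc_rel_arcs.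
  case/orP => uvE.
    suff: (u, v) \in B f by rewrite B0 finset.in_set0.
    by rewrite inE uvE /= e.
  suff: (v, u) \in B f by rewrite B0 finset.in_set0.
  by rewrite inE uvE /= -e sK.
have card_sum (X : {set {ffun V -> 'I_m}}) :
    (#|X|%:Z = \sum_(f : {ffun V -> 'I_m}) (f \in X)%:R :> int)%R.
  rewrite -sum1_card -natz natr_sum big_mkcond.
  by apply: eq_bigr => f _; case: ifP.
rewrite card_sum.
under eq_bigr => f _ do rewrite tB -sum_sign_subset big_mkcond.
rewrite exchange_big /= [RHS]big_mkcond /=; apply: eq_bigr => A _.
case: ifP => AE; last first.
  apply: big1 => f _; case: ifP => // AB; move: AE.
  rewrite (fintype.subset_trans AB) //.
  by apply/fintype.subsetP => e; rewrite inE => /andP[].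
rewrite card_sum mulr_sumr; apply: eq_bigr => f _.
have -> : (A \subset B f) = (f \in violating s A).
  rewrite inE; apply/fintype.subsetP/forall_inP => [AB e /AB|AB e eA].
    by rewrite inE => /andP [].
  by rewrite inE (fintype.subsetP AE) //= AB.
by case: ifP; rewrite ?mulr1 ?mulr0.
Qed.

Section FixedArcs.
Variables (s : V -> V -> 'I_m -> 'I_m) (A : {set V * V}).
Hypothesis (sK : matching_system s) (AE : A \subset arcs G).

Lemma violating_arc_rel f u v :
  f \in violating s A -> arc_rel A u v -> s u v (f u) = f v.
Proof.
move=> /violatingP fA /orP [/fA //|vuA]; rewrite -(fA _ _ vuA) sK //.
by apply: (arc_rel_edge AE); rewrite /arc_rel vuA.
Qed.

Lemma violating_determined f f' u v :
  f \in violating s A -> f' \in violating s A -> connect (arc_rel A) u v ->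
  f u = f' u -> f v = f' v.
Proof.
move=> fA f'A /connectP [p + ->]; elim: p u => //= w p IHp u /andP [uw wp] e.
by apply: (IHp w) => //; rewrite -(violating_arc_rel fA uw) e violating_arc_rel.
Qed.

(** The values of [f] at the component roots determine [f], so copying them over the components is
    injective; the result is constant on components. *)
Lemma card_violating_le_untwisted : #|violating s A| <= #|violating untwisted A|.
Proof.
pose r := fingraph.root (arc_rel A).
have cs := arc_rel_connect_sym A.
pose F f := [ffun v => f (r v)].
rewrite -(@card_in_imset _ _ F) => [|f f' fA f'A /ffunP FF]; last first.
  apply/ffunP => v; apply: (violating_determined fA f'A (u := r v)).
    by rewrite cs connect_root.
  by have := FF v; rewrite !ffunE.
apply/subset_leq_card/fintype.subsetP => _ /imsetP [f fA ->].
apply/violatingP => u v uvA; rewrite !ffunE /untwisted; congr (f _).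
by apply/(fingraph.rootP cs)/connect1; rewrite /arc_rel uvA.
Qed.

(** Values propagate along paths in [A], so restriction to [T] is injective. *)
Lemma card_violating_le_dominating (T : {set V}) :
  (forall v, exists2 t, t \in T & connect (arc_rel A) t v) ->
  #|violating s A| <= m ^ #|T|.
Proof.
move=> Tdom.
pose F f : {ffun {v | v \in T} -> 'I_m} := [ffun t => f (val t)].
have -> : m ^ #|T| = #|{ffun {v | v \in T} -> 'I_m}|.
  by rewrite card_ffun card_ord card_sig; congr (_ ^ _); apply: eq_card.
apply: (@leq_card_in _ _ F) => f f' fA f'A /ffunP FF.
apply/ffunP => v; have [t tT tv] := Tdom v.
apply: (violating_determined fA f'A tv).
by have := FF (Sub t tT); rewrite !ffunE.
Qed.

(* Relabelling the lists along phi turns the twists on the arcs of A into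
   identities. *)
Lemma cycle_or_gauge :
  (exists c, 2 < size c /\ ucycle (arc_rel A) c) \/
  exists phi : V -> {perm 'I_m},
    forall u v, (u, v) \in A -> forall i, phi v (s u v i) = phi u i.
Proof.
have [n le_n] := ubnP #|A|; elim: n A AE le_n => // n IHn B BE le_n.
case: (set_0Vmem B) => [->|[[u v] uvB]].
  by right; exists (fun=> 1%g) => u v; rewrite finset.in_set0.
have sB : B :\ (u, v) \subset B by apply: subsetDl.
have [|||] := IHn (B :\ (u, v))%SET.
- exact: fintype.subset_trans BE.
- by move: le_n; rewrite (cardsD1 (u, v)) uvB.
- move=> [c [c3 /andP [Cc Uc]]]; left; exists c; split=> //.
  by apply/andP; split=> //; apply: sub_cycle Cc; apply: arc_relS.
move=> [phi phiP].
case: (boolP (connect (arc_rel (B :\ (u, v))) u v)) => [uv|nuv].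
  by left; apply: (cycle_of_connected_arc BE uvB uv).
right; have Guv : G u v by apply: (arc_rel_edge BE); rewrite /arc_rel uvB.
pose t := perm (can_inj (sK Guv)).
(* Correct [phi] on the component of [v] by one fixed permutation, chosen so that [psi v] is [t^-1]
   followed by [phi u]. The vertex [u] lies outside this component and keeps its label. *)
pose psi w := if connect (arc_rel (B :\ (u, v))) v w
  then (phi w * ((phi v)^-1 * t^-1 * phi u))%g else phi w.
exists psi => x y xyB i.
case: (eqVneq (x, y) (u, v)) => [[-> ->]|ne].
  rewrite /psi connect0 arc_rel_connect_sym (negbTE nuv) !permM permK.
  by rewrite -(permE (can_inj (sK Guv))) permK.
have xyB' : (x, y) \in (B :\ (u, v))%SET by rewrite !inE ne.
(* Both ends of a remaining arc lie in the same component, so both or neither are corrected. *)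
have -> : psi y = if connect (arc_rel (B :\ (u, v))) v x
  then (phi y * ((phi v)^-1 * t^-1 * phi u))%g else phi y.
  rewrite /psi; congr (if _ then _ else _).
  rewrite ![connect _ v _]arc_rel_connect_sym.
  apply: same_connect; first exact: arc_rel_connect_sym.
  by apply: connect1; rewrite /arc_rel xyB' orbT.
by rewrite /psi; case: ifP => _; rewrite ?permM phiP.
Qed.

(** Composing with the inverse relabellings embeds the untwisted violators into the twisted ones;
    the other inequality is [card_violating_le_untwisted]. *)
Lemma card_violating_gauge (phi : V -> {perm 'I_m}) :
  (forall u v, (u, v) \in A -> forall i, phi v (s u v i) = phi u i) ->
  #|violating s A| = #|violating untwisted A|.
Proof.
move=> phiP; apply/eqP; rewrite eqn_leq card_violating_le_untwisted /=.
pose F f := [ffun v => (phi v)^-1%g (f v)].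
rewrite -(@card_imset _ _ F) => [|f f' /ffunP FF]; last first.
  by apply/ffunP => v; have := FF v; rewrite !ffunE => /perm_inj.
apply/subset_leq_card/fintype.subsetP => _ /imsetP [f /violatingP fA ->].
apply/violatingP => u v uvA; rewrite !ffunE; apply: (@perm_inj _ (phi v)).
by rewrite phiP // !permKV -(fA _ _ uvA).
Qed.

End FixedArcs.

(** The factor [2 ^ #|arcs G|] counts the edge sets. The case split keeps the truncated exponent
    from giving [m ^ 0 = 1] where the bound has to be 0. *)
Lemma card_twisted_colorings_le s g : matching_system s -> 0 < m -> odd g ->
  (forall c, is_cycle G c -> g <= (size c).+1) ->
  #|twisted_colorings s| <= chromatic_poly G m +
    (if g <= #|V|.+1 then 2 ^ #|arcs G| * m ^ (#|V|.+1 - g) else 0).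
Proof.
move=> sK m0 og girth_g; rewrite -twisted_colorings_untwisted -lez_nat PoszD.
rewrite -lerBlDl !twisted_colorings_inclusion_exclusion // -sumrB.
pose b := if g <= #|V|.+1 then m ^ (#|V|.+1 - g) else 0.
apply: (@le_trans _ _ (\sum_(A : {set V * V} | A \subset arcs G) b%:Z)%R).
  apply: ler_sum => A AE; rewrite -mulrBr.
  have le_un := card_violating_le_untwisted sK AE.
  case: (cycle_or_gauge sK AE) => [[c [c3 Cc]]|[phi phiP]]; last first.
    by rewrite (card_violating_gauge sK AE phiP) subrr mulr0.
  case: (cyclic_arcs_cases AE c3 Cc og girth_g) => [evA|[T Tg Tdom]].
    rewrite -signr_odd (negbTE evA) expr0 mul1r.
    by apply: (@le_trans _ _ 0%R); rewrite ?subr_le0 ?lez_nat.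
  have le_b : #|violating untwisted A| <= b.
    have sK1 := matching_system_untwisted.
    apply: leq_trans (card_violating_le_dominating sK1 AE Tdom) _.
    (* The existence of [T] rules out the zero branch of [b]. *)
    rewrite /b; have -> : g <= #|V|.+1 by lia.
    by apply: leq_pexp2l => //; lia.
  (* Both counts lie between 0 and [b], so either sign gives a difference of at most [b]. *)
  rewrite -signr_odd; case: odd; rewrite ?expr0 ?expr1; lia.
rewrite sumr_const -mulr_natr natz -PoszM lez_nat.
have -> : #|[pred A : {set V * V} | A \subset arcs G]| = 2 ^ #|arcs G|.
  by rewrite -card_powerset; apply: eq_card => A; rewrite powersetE.
by rewrite /b; case: ifP => // _; rewrite mulnC.
Qed.

End TwistedColorings.

(** * From full covers to the dual DP color function *)

Section FullCovers.
Variables (V : finType) (G : sgraph V) (m : nat).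

Section Labelling.
Variables (C : Defs.cover G) (fullC : full_cover m C).
Let H := cgraph C.
Let L := clist C.

Let lab u (i : 'I_m) : cvertex C :=
  enum_val (cast_ord (esym (fullC.1 u)) i).

Let lab_in u i : lab u i \in L u.
Proof. exact: enum_valP. Qed.

Let lab_inj u : injective (lab u).
Proof. by move=> i j /enum_val_inj /cast_ord_inj. Qed.

Let lab_surj u a : a \in L u -> exists i, lab u i = a.
Proof.
move=> aL; exists (cast_ord (fullC.1 u) (enum_rank_in aL a)).
by rewrite /lab cast_ordK enum_rankK_in.
Qed.

Let L_inj u v a : a \in L u -> a \in L v -> u = v.
Proof.
move=> au av; apply/eqP; apply: contraT => /(clist_disjoint C) /setP /(_ a).
by rewrite finset.in_setI au av finset.in_set0.
Qed.

(** On an edge of [G] the matching is perfect, so a partner exists and the default [i] is never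
    returned. *)
Let s u v i := odflt i [pick j | H (lab u i) (lab v j)].

Let sP u v i j : G u v -> (s u v i == j) = H (lab u i) (lab v j).
Proof.
move=> Guv; have [match_uv matched _] := fullC.2 u v Guv; rewrite /s.
case: pickP => [j' Hj'|noj] /=.
  apply/eqP/idP => [<- //|Hj]; apply: (@lab_inj v).
  by have [] := match_uv _ _ _ _ (lab_in u i) (lab_in u i) (lab_in v j')
    (lab_in v j) Hj' Hj (or_introl erefl).
have [b /lab_surj [j' <-] Hj'] := matched _ (lab_in u i).
by have := noj j'; rewrite /H Hj'.
Qed.

Let sK : matching_system G s.
Proof.
move=> u v Guv i; apply/eqP; rewrite sP; last by rewrite edge_sym.
by rewrite edge_sym -sP.
Qed.

(** Each list is a clique, so [S] meets it at most once; [#|S| = #|V|] then forces exactly one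
    element in every list. *)
Let transversal_of_independent (S : {set cvertex C}) :
  independent H S -> #|S| = #|V| ->
  exists2 f : {ffun V -> 'I_m}, f \in twisted_colorings G s &
    S = [set lab u (f u) | u in V]%SET.
Proof.
move=> indS cardS.
have indSP a b : a \in S -> b \in S -> H a b = false.
  move=> aS bS; apply/negbTE.
  by move/forall_inP: indS => /(_ a aS) /forall_inP /(_ b bS).
pose own (a : cvertex C) := xchoose (clist_cover a).
have ownP a : a \in L (own a) by exact: (xchooseP (clist_cover a)).
have own_inj : {in S &, injective own}.
  move=> a b aS bS ab; apply/eqP; apply: contraT => nab.
  rewrite -(indSP a b aS bS); apply: (clist_clique (ownP a)) nab.
  by rewrite ab; apply: ownP.
have own_surj u : exists i, lab u i \in S.
  have : u \in (own @: S)%SET.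
    suff -> : (own @: S)%SET = [set: V]%SET by rewrite finset.in_setT.
    apply/eqP; rewrite eqEcard finset.subsetT cardsT card_in_imset //.
    by rewrite cardS leqnn.
  move=> /imsetP [a aS ->]; have [i ia] := lab_surj (ownP a).
  by exists i; rewrite ia.
have [f fS] := fin_all_exists own_surj.
exists [ffun u => f u].
  rewrite inE; apply/forallP => u; apply/forallP => v; apply/implyP => Guv.
  by rewrite !ffunE sP // indSP.
apply/eqP; rewrite eq_sym eqEcard; apply/andP; split.
  by apply/fintype.subsetP => _ /imsetP [u _ ->]; rewrite ffunE.
rewrite cardS card_imset // => u v; rewrite !ffunE => e.
by apply: (L_inj (lab_in u (f u))); rewrite e.
Qed.

Lemma PDP_le_twisted_colorings :
  exists2 s, matching_system G s & PDP C <= #|@twisted_colorings V G m s|.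
Proof.
exists s => //; pose F f := [set lab u ((f : {ffun V -> 'I_m}) u) | u in V]%SET.
apply: leq_trans (leq_imset_card F _).
apply/subset_leq_card/fintype.subsetP => S; rewrite inE => /andP [indS /eqP cS].
have [f fT SE] := transversal_of_independent indS cS.
by apply/imsetP; exists f.
Qed.

End Labelling.

(** * The cover with identity matchings *)

Section Canonical.

Let W : finType := (V * 'I_m)%type.
Let adj : rel W := fun a b =>
  if a.1 == b.1 then a.2 != b.2 else G a.1 b.1 && (a.2 == b.2).

Let adj_sym : symmetric adj.
Proof.
by move=> a b; rewrite /adj (eq_sym b.1) (eq_sym b.2) (edge_sym G b.1).
Qed.

Let adj_irrefl : irreflexive adj.
Proof. by move=> a; rewrite /adj !eqxx. Qed.

Let H := SGraph adj_sym adj_irrefl.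
Let L u : {set W} := [set (u, i) | i in 'I_m]%SET.

Let LP u a : (a \in L u) = (a.1 == u).
Proof.
case: a => x i; apply/imsetP/eqP => [[j _ [-> _]] //|/= ->].
by exists i.
Qed.

Let L_disjoint u v : u != v -> L u :&: L v = finset.set0.
Proof.
move=> uv; apply/setP => a; rewrite finset.in_setI finset.in_set0 !LP.
by apply: contraNF uv => /andP [/eqP <- /eqP <-].
Qed.

Let L_cover a : exists u, a \in L u.
Proof. by exists a.1; rewrite LP. Qed.

Let L_clique u a b : a \in L u -> b \in L u -> a != b -> H a b.
Proof.
case: a b => [x i] [y j]; rewrite !LP /= /adj /= => /eqP -> /eqP ->.
by rewrite eqxx xpair_eqE eqxx.
Qed.

Let L_matching u v : u != v -> matching_between H (L u) (L v).
Proof.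
move=> /negbTE uv [x i] [x' i'] [y j] [y' j']; rewrite !LP /= /adj /=.
move=> /eqP -> /eqP -> /eqP -> /eqP ->; rewrite uv.
by move=> /andP[_ /eqP ->] /andP[_ /eqP ->] [] [->].
Qed.

Let L_nonadjacent u v a b : u != v -> ~~ G u v ->
  a \in L u -> b \in L v -> ~~ H a b.
Proof.
move=> /negbTE uv /negbTE nG; rewrite !LP /= /adj => /eqP -> /eqP ->.
by rewrite uv nG.
Qed.

Let C := Cover L_disjoint L_cover L_clique L_matching L_nonadjacent.

(** The graph of a proper coloring, as a set of pairs, is an independent transversal of this cover
    and determines the coloring. *)
Lemma exists_full_cover_chromatic :
  exists2 C : Defs.cover G, full_cover m C & chromatic_poly G m <= PDP C.
Proof.
exists C.
  split=> [u|u v Guv] /=.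
    by rewrite card_imset ?card_ord // => i j [].
  have uv : u != v by apply: contraTneq Guv => ->; rewrite edge_irrefl.
  split=> [|[x i]|[x i]]; rewrite ?LP /=; first exact: L_matching.
    move=> /eqP ->; exists (v, i); rewrite ?LP //= /adj /=.
    by rewrite (negbTE uv) Guv eqxx.
  move=> /eqP ->; exists (u, i); rewrite ?LP //= /adj /=.
  by rewrite (negbTE uv) Guv eqxx.
pose F (f : {ffun V -> 'I_m}) := [set (u, f u) | u in V]%SET.
rewrite /chromatic_poly -(@card_imset _ _ F) => [|f f' FF]; last first.
  apply/ffunP => u; have: (u, f u) \in F f' by rewrite -FF; apply: imset_f.
  by case/imsetP => v _ [-> ->].
apply/subset_leq_card/fintype.subsetP => _ /imsetP [f + ->].
rewrite !inE => /forallP fP; apply/andP; split; last first.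
  by rewrite card_imset // => u v [].
apply/forall_inP => _ /imsetP [u _ ->]; apply/forall_inP => _ /imsetP [v _ ->].
rewrite /= /adj /=; case: eqP => [->|_]; first by rewrite eqxx.
by have /forallP/(_ v) := fP u; case: (G u v).
Qed.

End Canonical.

(** This makes the difference in the theorem nonnegative, so only an upper bound remains. *)
Lemma chromatic_poly_le_dual_PDP : chromatic_poly G m <= dual_PDP G m.
Proof.
have [_ dual_ub] := dual_PDPP G m.
have [C fullC le_C] := exists_full_cover_chromatic.
by apply: leq_trans le_C _; apply: dual_ub; exists C.
Qed.

Lemma dual_PDP_le_chromatic_poly g : 0 < m -> odd g ->
  (forall c, is_cycle G c -> g <= (size c).+1) ->
  dual_PDP G m <= chromatic_poly G m +
    (if g <= #|V|.+1 then 2 ^ #|arcs G| * m ^ (#|V|.+1 - g) else 0).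
Proof.
move=> m0 og girth_g; have [[C fullC <-] _] := dual_PDPP G m.
have [s sK le_C] := PDP_le_twisted_colorings fullC.
by apply: leq_trans le_C _; apply: card_twisted_colorings_le.
Qed.

End FullCovers.

(** * The asymptotic estimate *)

Import numFieldNormedType.Exports.

Local Open Scope classical_set_scope.
Local Open Scope ring_scope.

Theorem theorem4 (R : realType) (V : finType) (G : sgraph V) (g : nat)
    (hg3 : (3 <= g)%N) (hgodd : odd g)
    (hgirth : ((g%:R - 1)%:E <= girth R G)%E) :
  (fun m : nat => (dual_PDP G m)%:R - (chromatic_poly G m)%:R : R)
    =O_\oo (fun m : nat => m%:R ^ (#|V|%:Z - g%:Z + 1) : R).
Proof.
have girth_g c : is_cycle G c -> (g <= (size c).+1)%N.
  move=> Cc; have : (girth R G <= (size c)%:R%:E)%E.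
    by apply: ereal_inf_lbound; exists c.
  by move/(le_trans hgirth); rewrite lee_fin lerBlDr natr1 ler_nat.
(* The constant is the number of edge sets of [G], valid for all [m] from 1 on. *)
apply/eqO_exP; exists (2 ^ #|arcs G|)%:R; first by rewrite ltr0n expn_gt0.
exists 1%N => // m /= m0.
have le_m := dual_PDP_le_chromatic_poly m0 hgodd girth_g.
have ge_m := chromatic_poly_le_dual_PDP G m.
rewrite -natrB // ger0_norm ?ler0n //.
(* If [g] exceeds [#|V|.+1] the exponent is negative, but the difference is exactly 0. *)
move: le_m; case: ifP => [gV le_m|_ le_m]; last first.
  have -> : (dual_PDP G m - chromatic_poly G m = 0)%N by lia.
  by rewrite mulr_ge0 ?ler0n ?normr_ge0.
have -> : #|V|%:Z - g%:Z + 1 = (#|V|.+1 - g)%N by lia.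
rewrite -[X in `|X|]/(m%:R ^+ _) ger0_norm ?exprn_ge0 ?ler0n //.
by rewrite -natrX -natrM ler_nat leq_subLR.
Qed.
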